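(* Let $R=\prod_{i=1}^n R_i$ be a (finite) direct product of rings and let $N=N_1\oplus\cdots\oplus N_n$ be a decomposition of a left $R$-module $N$ into left $R_i$-modules $N_i$. Then $$\mathrm{Gfd}_R(N)=\sup\{\mathrm{Gfd}_{R_i}(N_i)\mid i=1,\dots,n\}.$$
   Context: All rings are associative with identity and all modules are unitary. Every left module $N$ over $R=\prod_{i=1}^n R_i$ is of the form $N=N_1\oplus\cdots\oplus N_n$ with $N_i$ a left $R_i$-module, where $R$ acts componentwise: $(r_1,\dots,r_n)(x_1,\dots,x_n)=(r_1x_1,\dots,r_nx_n)$. For a ring $S$, a left $S$-module $M$ is Gorenstein flat if there exists an exact sequence of flat left $S$-modules $\cdots\to F_1\to F_0\to F^0\to F^1\to\cdots$ such that $M\cong \mathrm{Im}(F_0\to F^0)$ and such that $I\otimes_S -$ leaves the sequence exact whenever $I$ is an injective right $S$-module. For an integer $m\ge 0$, $\mathrm{Gfd}_S(M)\le m$ means that there is an exact sequence of left $S$-modules $0\to G_m\to\cdots\to G_0\to M\to 0$ with each $G_j$ Gorenstein flat; $\mathrm{Gfd}_S(M)$ (the Gorenstein flat dimension) is the least such $m$, and $\infty$ if there is none. *)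

(* Defs.v *)
From HB Require Import structures.
From mathcomp Require Import all_boot all_order all_algebra.
From mathcomp Require Import boolp classical_sets constructive_ereal.
From mathcomp.multinomials Require Import freeg.

Set Implicit Arguments.
Unset Strict Implicit.
Unset Printing Implicit Defensive.

Import Order.TTheory GRing.Theory Num.Theory.

Local Open Scope ring_scope.
Local Open Scope quotient_scope.

(* Rings are [pzRingType]s, so the zero ring is allowed and commutativity is
   not assumed.  A left S-module is an [lmodType S]; a right S-module is an
   [lmodType S^c], with r *: x standing for x r. *)

Section ProductRing.
Variables (I : Type) (R : I -> pzRingType).

Definition prod_ring : Type := forall i, R i.

HB.instance Definition _ := Choice.on prod_ring.

Implicit Types x y z : prod_ring.

Let prod_zero : prod_ring := fun=> 0.
Let prod_opp x : prod_ring := fun i => - x i.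
Let prod_add x y : prod_ring := fun i => x i + y i.
Let prod_one : prod_ring := fun=> 1.
Let prod_mul x y : prod_ring := fun i => x i * y i.

Fact prod_ring_addA : associative prod_add.
Proof. by move=> x y z; apply: functional_extensionality_dep => i; apply: addrA. Qed.
Fact prod_ring_addC : commutative prod_add.
Proof. by move=> x y; apply: functional_extensionality_dep => i; apply: addrC. Qed.
Fact prod_ring_add0 : left_id prod_zero prod_add.
Proof. by move=> x; apply: functional_extensionality_dep => i; apply: add0r. Qed.
Fact prod_ring_addN : left_inverse prod_zero prod_opp prod_add.
Proof. by move=> x; apply: functional_extensionality_dep => i; apply: addNr. Qed.

HB.instance Definition _ := GRing.isZmodule.Build prod_ring
  prod_ring_addA prod_ring_addC prod_ring_add0 prod_ring_addN.

Fact prod_ring_mulA : associative prod_mul.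
Proof. by move=> x y z; apply: functional_extensionality_dep => i; apply: mulrA. Qed.
Fact prod_ring_mul1l : left_id prod_one prod_mul.
Proof. by move=> x; apply: functional_extensionality_dep => i; apply: mul1r. Qed.
Fact prod_ring_mul1r : right_id prod_one prod_mul.
Proof. by move=> x; apply: functional_extensionality_dep => i; apply: mulr1. Qed.
Fact prod_ring_mulDl : left_distributive prod_mul +%R.
Proof. by move=> x y z; apply: functional_extensionality_dep => i; apply: mulrDl. Qed.
Fact prod_ring_mulDr : right_distributive prod_mul +%R.
Proof. by move=> x y z; apply: functional_extensionality_dep => i; apply: mulrDr. Qed.

HB.instance Definition _ := GRing.Zmodule_isPzRing.Build prod_ring
  prod_ring_mulA prod_ring_mul1l prod_ring_mul1r
  prod_ring_mulDl prod_ring_mulDr.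

(* The direct product of the N i, which is their direct sum when I is finite. *)
Variable N : forall i, lmodType (R i).

Definition dsum_mod : Type := forall i, N i.

HB.instance Definition _ := Choice.on dsum_mod.

Implicit Types u v w : dsum_mod.

Let dsum_zero : dsum_mod := fun=> 0.
Let dsum_opp u : dsum_mod := fun i => - u i.
Let dsum_add u v : dsum_mod := fun i => u i + v i.
Let dsum_scale (r : prod_ring) u : dsum_mod := fun i => r i *: u i.

Fact dsum_mod_addA : associative dsum_add.
Proof. by move=> u v w; apply: functional_extensionality_dep => i; apply: addrA. Qed.
Fact dsum_mod_addC : commutative dsum_add.
Proof. by move=> u v; apply: functional_extensionality_dep => i; apply: addrC. Qed.
Fact dsum_mod_add0 : left_id dsum_zero dsum_add.
Proof. by move=> u; apply: functional_extensionality_dep => i; apply: add0r. Qed.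
Fact dsum_mod_addN : left_inverse dsum_zero dsum_opp dsum_add.
Proof. by move=> u; apply: functional_extensionality_dep => i; apply: addNr. Qed.

HB.instance Definition _ := GRing.isZmodule.Build dsum_mod
  dsum_mod_addA dsum_mod_addC dsum_mod_add0 dsum_mod_addN.

Fact dsum_mod_scalerA a b v :
  dsum_scale a (dsum_scale b v) = dsum_scale (a * b) v.
Proof. by apply: functional_extensionality_dep => i; apply: scalerA. Qed.
Fact dsum_mod_scale1r : left_id 1 dsum_scale.
Proof. by move=> u; apply: functional_extensionality_dep => i; apply: scale1r. Qed.
Fact dsum_mod_scalerDr : right_distributive dsum_scale +%R.
Proof. by move=> a u v; apply: functional_extensionality_dep => i; apply: scalerDr. Qed.
Fact dsum_mod_scalerDl v : {morph dsum_scale^~ v : a b / a + b}.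
Proof. by move=> a b; apply: functional_extensionality_dep => i; apply: scalerDl. Qed.

HB.instance Definition _ := GRing.Zmodule_isLmodule.Build prod_ring dsum_mod
  dsum_mod_scalerA dsum_mod_scale1r dsum_mod_scalerDr dsum_mod_scalerDl.

End ProductRing.

Definition lmod_iso (S : pzRingType) (M N : lmodType S) : Prop :=
  exists f : {linear M -> N}, bijective f.

Section Image.
Variables (S : pzRingType) (A B : lmodType S) (f : {linear A -> B}).

Definition image_pred : {pred B} := [pred y | `[< exists x, y = f x >]].

Fact image_submod_closed : submod_closed image_pred.
Proof.
split=> [|r _ _ /asboolP[x ->] /asboolP[y ->]]; apply/asboolP.
  by exists 0; rewrite linear0.
by exists (r *: x + y); rewrite linearP.
Qed.

HB.instance Definition _ := GRing.isSubmodClosed.Build S B image_pred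
  image_submod_closed.

Record image_mod : Type :=
  ImageMod { image_val : B; image_valP : image_val \in image_pred }.

HB.instance Definition _ := [isSub for image_val].
HB.instance Definition _ := [Choice of image_mod by <:].
HB.instance Definition _ := [SubChoice_isSubLmodule of image_mod by <:].

End Image.

Section Tensor.
Variables (S : pzRingType) (A : lmodType S^c) (B : lmodType S).

Let F := {freeg (A * B)%type / int}.
Let gen (a : A) (b : B) : F := << (a, b) >>.

(* The subgroup of the free abelian group on A * B generated by the relations
   that define the tensor product over S. *)
Inductive tensor_null : F -> Prop :=
| tensor_null0 : tensor_null 0
| tensor_nullB x y : tensor_null x -> tensor_null y -> tensor_null (x - y)
| tensor_nullDl a a' b : tensor_null (gen (a + a') b - gen a b - gen a' b)
| tensor_nullDr a b b' : tensor_null (gen a (b + b') - gen a b - gen a b')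
| tensor_nullZ (r : S) a b :
    tensor_null (gen ((r : S^c) *: a) b - gen a (r *: b)).

Definition tensor_pred : {pred F} := [pred x | `[< tensor_null x >]].

Fact tensor_zmod_closed : zmod_closed tensor_pred.
Proof.
split=> [|x y /asboolP nx /asboolP ny]; apply/asboolP.
  exact: tensor_null0.
exact: tensor_nullB.
Qed.

HB.instance Definition _ := GRing.isZmodClosed.Build F tensor_pred
  tensor_zmod_closed.

Definition tensor : Type := Quotient.quot tensor_pred.

HB.instance Definition _ := ZmodQuotient.on tensor.

Definition pure_tensor (a : A) (b : B) : tensor := \pi_tensor (gen a b).

Lemma tensor_eq (x y : F) :
  (\pi_tensor x = \pi_tensor y) <-> tensor_null (x - y).
Proof.
rewrite -[X in _ <-> X]asboolE -[`[< _ >]]/(x - y \in tensor_pred).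
by rewrite Quotient.idealrBE; split=> /eqP.
Qed.

Lemma pure_tensorDl a a' b :
  pure_tensor (a + a') b = pure_tensor a b + pure_tensor a' b.
Proof.
rewrite /pure_tensor -pi_addr; apply/tensor_eq; rewrite opprD addrA.
exact: tensor_nullDl.
Qed.

Lemma pure_tensorDr a b b' :
  pure_tensor a (b + b') = pure_tensor a b + pure_tensor a b'.
Proof.
rewrite /pure_tensor -pi_addr; apply/tensor_eq; rewrite opprD addrA.
exact: tensor_nullDr.
Qed.

Lemma pure_tensorZ (r : S) a b :
  pure_tensor ((r : S^c) *: a) b = pure_tensor a (r *: b).
Proof. by apply/tensor_eq; apply: tensor_nullZ. Qed.

End Tensor.

Section TensorMap.
Variables (S : pzRingType) (A A' : lmodType S^c) (B B' : lmodType S).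

Definition tensor_gen_map (f : A -> A') (g : B -> B') :
    {freeg (A * B)%type / int} -> {freeg (A' * B')%type / int} :=
  fglift (fun p => << (f p.1, g p.2) >>).

(* f (x) g; the value does not depend on the representative [repr z] as soon as
   f and g are linear, see [tensor_map_pi]. *)
Definition tensor_map (f : A -> A') (g : B -> B') (z : tensor A B) :
    tensor A' B' := \pi_(tensor A' B') (tensor_gen_map f g (repr z)).

Variables (f : {linear A -> A'}) (g : {linear B -> B'}).

Lemma tensor_gen_mapB : {morph tensor_gen_map f g : x y / x - y}.
Proof. exact: lift_is_additive. Qed.

Lemma tensor_gen_mapU p :
  tensor_gen_map f g << p >> = << (f p.1, g p.2) >>.
Proof. by rewrite /tensor_gen_map liftU scale1r. Qed.

Lemma tensor_null_map x : tensor_null x -> tensor_null (tensor_gen_map f g x).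
Proof.
elim=> {x} [|x y _ IHx _ IHy|a a' b|a b b'|r a b].
- rewrite -[X in tensor_gen_map _ _ X](subrr 0) tensor_gen_mapB subrr.
  exact: tensor_null0.
- by rewrite tensor_gen_mapB; apply: tensor_nullB.
- rewrite !tensor_gen_mapB !tensor_gen_mapU /= linearD; exact: tensor_nullDl.
- rewrite !tensor_gen_mapB !tensor_gen_mapU /= linearD; exact: tensor_nullDr.
- rewrite !tensor_gen_mapB !tensor_gen_mapU /= !linearZ; exact: tensor_nullZ.
Qed.

Lemma tensor_map_pi x :
  tensor_map f g (\pi_(tensor A B) x) = \pi_(tensor A' B') (tensor_gen_map f g x).
Proof.
apply/tensor_eq; rewrite -tensor_gen_mapB; apply: tensor_null_map.
by apply/tensor_eq; rewrite reprK.
Qed.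

Lemma tensor_map_pure a b :
  tensor_map f g (pure_tensor a b) = pure_tensor (f a) (g b).
Proof. by rewrite tensor_map_pi tensor_gen_mapU. Qed.

Lemma tensor_mapB : {morph tensor_map f g : x y / x - y}.
Proof.
move=> x y; rewrite -{1}[x]reprK -{1}[y]reprK -pi_oppr -pi_addr.
by rewrite tensor_map_pi tensor_gen_mapB pi_addr pi_oppr.
Qed.

HB.instance Definition _ :=
  GRing.isZmodMorphism.Build (tensor A B) (tensor A' B') (tensor_map f g)
    tensor_mapB.

End TensorMap.

Definition exact_at (A B C : zmodType) (f : A -> B) (g : B -> C) : Prop :=
  forall y, g y = 0 <-> exists x, y = f x.

(* Exactness, at every term, of
     ... -> L 1 -dl 0-> L 0 -e-> R 0 -dr 0-> R 1 -> ... *)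
Definition exact_biseq (L R : nat -> zmodType)
    (dl : forall k, L k.+1 -> L k) (e : L 0 -> R 0)
    (dr : forall k, R k -> R k.+1) : Prop :=
  [/\ forall k, exact_at (dl k.+1) (dl k),
      exact_at (dl 0) e,
      exact_at e (dr 0)
    & forall k, exact_at (dr k) (dr k.+1)].

Section GorensteinFlat.
Variable S : pzRingType.

Definition flat (M : lmodType S) : Prop :=
  forall (A A' : lmodType S^c) (f : {linear A -> A'}),
    injective f -> injective (tensor_map f (@idfun M)).

Definition injective_mod (T : pzRingType) (I : lmodType T) : Prop :=
  forall (A B : lmodType T) (f : {linear A -> B}) (g : {linear A -> I}),
    injective f -> exists h : {linear B -> I}, forall x, h (f x) = g x.

Definition gorenstein_flat (M : lmodType S) : Prop :=
  exists (L R : nat -> lmodType S)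
         (dl : forall k, {linear L k.+1 -> L k})
         (e : {linear L 0 -> R 0})
         (dr : forall k, {linear R k -> R k.+1}),
    [/\ forall k, flat (L k) /\ flat (R k),
        @exact_biseq L R dl e dr,
        lmod_iso M (image_mod e)
      & forall I : lmodType S^c, injective_mod I ->
          @exact_biseq (fun k => tensor I (L k)) (fun k => tensor I (R k))
            (fun k => tensor_map (@idfun I) (dl k))
            (tensor_map (@idfun I) e)
            (fun k => tensor_map (@idfun I) (dr k))].

(* An exact sequence 0 -> G_m -> ... -> G_0 -> M -> 0 is extended by G_k = 0
   for all k > m. *)
Definition Gfd_le (M : lmodType S) (m : nat) : Prop :=
  exists (G : nat -> lmodType S)
         (d : forall k, {linear G k.+1 -> G k})
         (eps : {linear G 0 -> M}),
    [/\ forall k, (k <= m)%N -> gorenstein_flat (G k),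
        forall k, (m < k)%N -> forall x : G k, x = 0,
        forall k, exact_at (d k.+1) (d k),
        exact_at (d 0) eps
      & forall y, exists x, y = eps x].

Let Gfd_leb (M : lmodType S) : pred nat := fun m => `[< Gfd_le M m >].

(* Takes values in the natural numbers and +oo. *)
Definition Gfd (M : lmodType S) : \bar int :=
  if pselect (exists m, Gfd_leb M m) is left finite_Gfd
  then (ex_minn finite_Gfd)%:Z%:E else +oo%E.

End GorensteinFlat.

(* Main.v *)
From HB Require Import structures.
Require Import Defs.
From mathcomp Require Import all_boot all_order all_algebra.
From mathcomp Require Import boolp classical_sets constructive_ereal.
From mathcomp.multinomials Require Import freeg.

(** The idempotents e_i of the product ring R are central and orthogonal with
    sum 1, and R_i is the corner e_i R.  So every R-module M is the direct sum
    of its components e_i M, an R-linear map is the family of its components,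
    and A tensor_R B is the direct sum of the groups e_i A tensor_(R_i) e_i B.
    A sequence of maps is then exact exactly when each of its components is, and
    this holds before as well as after tensoring.

    From this, flatness, injectivity and Gorenstein flatness are transported in
    both directions.
    - From R to R_i: the component functor keeps flat modules flat
      ([flat_component]).  An injective right R_i-module J is still injective
      when R acts on it through the projection to R_i ([injective_res]), and
      J tensor_R L is J tensor_(R_i) e_i L; hence the components of a complete
      flat resolution form one over R_i ([gorenstein_flat_component]).
    - From the R_i to R: a module with flat components is flat
      ([flat_components]), and the components of an injective right R-module are
      injective ([injective_component]); hence the direct sum of complete flat
      resolutions is a complete flat resolution ([gorenstein_flat_dsum]).

    Applied to each term of a finite Gorenstein flat resolution, this says that
    Gfd (N_1 + ... + N_n) <= m if and only if Gfd N_i <= m for all i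
    ([Gfd_le_dsumP]), because a resolution of length at most m can be padded
    with zero modules to have length exactly m.  A quantity in the natural
    numbers and infinity is determined by its finite upper bounds, which gives
    the supremum; for n = 0 both sides are 0, as N is then zero.

    Most of the argument does not see the product: it concerns one corner T of
    a ring S, cut out by a central idempotent ([ring_factor]), which also makes
    it apply to the opposite rings and thus to right modules.  All comparisons
    go through one notion, [summand], of a group that is a direct summand of
    another together with its projection and injection. *)

Set Implicit Arguments.
Unset Strict Implicit.
Unset Printing Implicit Defensive.

Import Order.TTheory GRing.Theory Num.Theory.

Local Open Scope ring_scope.
Local Open Scope classical_set_scope.
Local Open Scope quotient_scope.

(** * Direct summands and exactness *)

Record summand (X X' : zmodType) := Summand {
  summand_proj : {additive X -> X'};
  summand_inj : {additive X' -> X};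
  summand_injK : cancel summand_inj summand_proj
}.

(** The first condition carries equations from X down to X', the second carries
    elements of X' up to X; together they force [f'] to be proj \o f \o inj. *)
Definition summand_hom (X X' Y Y' : zmodType) (s : summand X X')
    (t : summand Y Y') (f : X -> Y) (f' : X' -> Y') : Prop :=
  (forall x, summand_proj t (f x) = f' (summand_proj s x)) /\
  (forall x, f (summand_inj s x) = summand_inj t (f' x)).

Lemma summand_hom_id (X X' : zmodType) (s : summand X X') :
  summand_hom s s idfun idfun.
Proof. by []. Qed.

(** The resolution of the identity that turns a family of summands into a
    decomposition; it allows a statement to be glued from the summands. *)
Definition spanning (I : finType) (X : zmodType) (X_ : I -> zmodType)
    (s : forall i, summand X (X_ i)) : Prop :=
  forall x, \sum_i summand_inj (s i) (summand_proj (s i) x) = x.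

Section OneSummand.
Variables (X Y Z X' Y' Z' : zmodType).
Variables (s : summand X X') (t : summand Y Y') (u : summand Z Z').
Variables (f : X -> Y) (g : Y -> Z) (f' : X' -> Y') (g' : Y' -> Z').
Hypotheses (hf : summand_hom s t f f') (hg : summand_hom t u g g').

(** Lift a cycle along the injection, write it as a boundary there, and project
    the preimage back. *)
Lemma exact_at_summand : exact_at f g -> exact_at f' g'.
Proof.
case: hf hg => [pf qf] [pg qg] ex y; split=> [gy0|[x ->]].
  have /ex[x yE] : g (summand_inj t y) = 0 by rewrite qg gy0 raddf0.
  by exists (summand_proj s x); rewrite -pf -yE summand_injK.
have /ex gfx0 : exists x1, f (summand_inj s x) = f x1.
  by exists (summand_inj s x).
by rewrite -[f' x](summand_injK t) -qf -pg gfx0 raddf0.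
Qed.

Lemma injective_summand : injective f -> injective f'.
Proof.
case: hf => [_ qf] injf x y fxy; apply: (can_inj (summand_injK s)).
by apply: injf; rewrite !qf fxy.
Qed.

Lemma image_summand y' :
  (exists x', y' = f' x') <-> (exists x, summand_inj t y' = f x).
Proof.
case: hf => [pf qf]; split=> [[x' ->]|[x yE]].
  by exists (summand_inj s x').
by exists (summand_proj s x); rewrite -pf -yE summand_injK.
Qed.

Lemma surjective_summand :
  (forall y, exists x, y = f x) -> forall y, exists x, y = f' x.
Proof. by move=> surf y; apply/image_summand. Qed.

End OneSummand.

Section SpanningSummands.
Variables (I : finType) (X Y : zmodType) (X_ Y_ : I -> zmodType).
Variables (s : forall i, summand X (X_ i)) (t : forall i, summand Y (Y_ i)).
Hypotheses (span_s : spanning s) (span_t : spanning t).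
Variables (f : {additive X -> Y}) (f_ : forall i, X_ i -> Y_ i).
Hypothesis hf : forall i, summand_hom (s i) (t i) f (@f_ i).

Lemma eq_spanning x y :
  (forall i, summand_proj (t i) x = summand_proj (t i) y) -> x = y.
Proof.
move=> xy; rewrite -(span_t x) -(span_t y).
by apply: eq_bigr => i _; rewrite xy.
Qed.

(** Preimages chosen in each summand are glued by adding their injections. *)
Lemma image_spanning y :
  (exists x, y = f x) <-> forall i, exists x, summand_proj (t i) y = f_ x.
Proof.
split=> [[x ->] i|/(_ _)/cid h].
  by exists (summand_proj (s i) x); rewrite (hf i).1.
exists (\sum_i summand_inj (s i) (projT1 (h i))).
rewrite raddf_sum -[LHS]span_t; apply: eq_bigr => i _.
by rewrite (hf i).2 {1}(projT2 (h i)).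
Qed.

Lemma surjective_spanning :
  (forall i (y : Y_ i), exists x, y = f_ x) -> forall y, exists x, y = f x.
Proof. by move=> surf y; apply/image_spanning => i; apply: surf. Qed.

Lemma injective_spanning :
  (forall i, injective (@f_ i)) -> injective f.
Proof.
move=> injf x y fxy; rewrite -(span_s x) -(span_s y).
apply: eq_bigr => i _; congr (summand_inj _ _); apply: injf.
by rewrite -!(hf i).1 fxy.
Qed.

End SpanningSummands.

Lemma exact_at_spanning (I : finType) (X Y Z : zmodType)
    (X_ Y_ Z_ : I -> zmodType)
    (s : forall i, summand X (X_ i)) (t : forall i, summand Y (Y_ i))
    (u : forall i, summand Z (Z_ i)) (f : {additive X -> Y}) (g : Y -> Z)
    (f_ : forall i, X_ i -> Y_ i) (g_ : forall i, Y_ i -> Z_ i) :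
  spanning t -> spanning u ->
  (forall i, summand_hom (s i) (t i) f (@f_ i)) ->
  (forall i, summand_hom (t i) (u i) g (@g_ i)) ->
  (forall i, exact_at (@f_ i) (@g_ i)) -> exact_at f g.
Proof.
move=> span_t span_u hf hg ex y; split=> [gy0|[x ->]].
  apply/(image_spanning span_t hf) => i; apply/ex.
  by rewrite -(hg i).1 gy0 raddf0.
apply: (eq_spanning span_u) => i; rewrite (hg i).1 (hf i).1 raddf0.
by apply/ex; exists (summand_proj (s i) x).
Qed.

Section ExactBiseq.
Variables (I : finType) (L R : nat -> zmodType) (L_ R_ : I -> nat -> zmodType).
Variables (sL : forall k i, summand (L k) (L_ i k)).
Variables (sR : forall k i, summand (R k) (R_ i k)).
Variables (dl : forall k, {additive L k.+1 -> L k}) (e : {additive L 0 -> R 0}).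
Variables (dr : forall k, {additive R k -> R k.+1}).
Variables (dl_ : forall i k, L_ i k.+1 -> L_ i k).
Variables (e_ : forall i, L_ i 0 -> R_ i 0).
Variables (dr_ : forall i k, R_ i k -> R_ i k.+1).
Hypothesis hdl : forall k i, summand_hom (sL k.+1 i) (sL k i) (dl k) (@dl_ i k).
Hypothesis he : forall i, summand_hom (sL 0 i) (sR 0 i) e (@e_ i).
Hypothesis hdr : forall k i, summand_hom (sR k i) (sR k.+1 i) (dr k) (@dr_ i k).

Lemma exact_biseq_spanning :
  (forall k, spanning (sL k)) -> (forall k, spanning (sR k)) ->
  (forall i, exact_biseq (@dl_ i) (@e_ i) (@dr_ i)) -> exact_biseq dl e dr.
Proof.
move=> spanL spanR ex; split=> [k|||k].
- apply: (exact_at_spanning (spanL k.+1) (spanL k) (hdl _) (hdl _)) => i.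
  by case: (ex i) => + _ _ _; apply.
- apply: (exact_at_spanning (spanL 0) (spanR 0) (hdl _) he) => i.
  by case: (ex i).
- apply: (exact_at_spanning (spanR 0) (spanR 1) he (hdr _)) => i.
  by case: (ex i).
- apply: (exact_at_spanning (spanR k.+1) (spanR k.+2) (hdr _) (hdr _)) => i.
  by case: (ex i) => _ _ _; apply.
Qed.

End ExactBiseq.

Lemma exact_biseq_summand (L R L' R' : nat -> zmodType)
    (sL : forall k, summand (L k) (L' k)) (sR : forall k, summand (R k) (R' k))
    (dl : forall k, L k.+1 -> L k) (e : L 0 -> R 0)
    (dr : forall k, R k -> R k.+1)
    (dl' : forall k, L' k.+1 -> L' k) (e' : L' 0 -> R' 0)
    (dr' : forall k, R' k -> R' k.+1) :
  (forall k, summand_hom (sL k.+1) (sL k) (@dl k) (@dl' k)) ->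
  summand_hom (sL 0) (sR 0) e e' ->
  (forall k, summand_hom (sR k) (sR k.+1) (@dr k) (@dr' k)) ->
  exact_biseq dl e dr -> exact_biseq dl' e' dr'.
Proof.
move=> hdl he hdr [exl exl0 exr0 exr].
split=> [k|||k].
- exact: exact_at_summand (hdl _) (hdl _) (exl k).
- exact: exact_at_summand (hdl _) he exl0.
- exact: exact_at_summand he (hdr _) exr0.
- exact: exact_at_summand (hdr _) (hdr _) (exr k).
Qed.

(** * The universal property of the tensor product *)

Section TensorUniversal.
Variables (S : pzRingType) (A : lmodType S^c) (B : lmodType S).

(** Pure tensors generate the tensor product as a group; negatives and sums are
    both obtained from the closure under subtraction. *)
Lemma tensor_sub_ind (P : tensor A B -> Prop) :
  P 0 -> (forall x y, P x -> P y -> P (x - y)) ->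
  (forall a b, P (pure_tensor a b)) -> forall z, P z.
Proof.
move=> P0 PB Ppure z; rewrite -[z]reprK -[repr z]freeg_sumE.
have PN x : P x -> P (- x) by move=> Px; rewrite -sub0r; apply: PB.
have PD x y : P x -> P y -> P (x + y).
  by move=> Px Py; rewrite -[y]opprK; apply/PB/PN.
have -> : forall (s : seq _) (F : _ -> {freeg (A * B)%type / int}),
    \pi_(tensor A B) (\sum_(z <- s) F z) = \sum_(z <- s) \pi_(tensor A B) (F z).
  move=> s F; apply: big_morph => [x y|]; first by rewrite pi_addr.
  by rewrite -[X in \pi X]/(0 : {freeg (A * B)%type / int}) pi_zeror.
apply: (big_ind P) => // p _.
have PMn m : P (\pi_(tensor A B) << m%:Z *g p >>).
  elim: m => [|m IH]; first by rewrite freegU0 pi_zeror.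
  rewrite -addn1 PoszD -freegUD pi_addr; apply: PD => //.
  by case: p {IH} => a b; apply: Ppure.
case: (coeff p _) => m; first exact: PMn.
by rewrite NegzE -freegUN pi_oppr; apply/PN/PMn.
Qed.

Lemma eq_tensor (X : zmodType) (f g : {additive tensor A B -> X}) :
  (forall a b, f (pure_tensor a b) = g (pure_tensor a b)) -> f =1 g.
Proof.
move=> fg; elim/tensor_sub_ind => [|x y fx fy|//]; first by rewrite !raddf0.
by rewrite !raddfB fx fy.
Qed.

Variables (X : zmodType) (phi : A -> B -> X).

(** The formula makes sense for every [phi]; it is the induced homomorphism only
    when [phi] is balanced, as the relations then go to zero. *)
Definition tensor_lift (z : tensor A B) : X :=
  fglift (fun p => phi p.1 p.2 : zmodule X) (repr z).

Hypothesis phiDl : forall a a' b, phi (a + a') b = phi a b + phi a' b.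
Hypothesis phiDr : forall a b b', phi a (b + b') = phi a b + phi a b'.
Hypothesis phiZ : forall (r : S) a b, phi ((r : S^c) *: a) b = phi a (r *: b).

(** Each of the defining relations of the tensor product is sent to zero, so the
    value depends only on the class. *)
Lemma tensor_lift_pi x :
  tensor_lift (\pi_(tensor A B) x) =
  fglift (fun p => phi p.1 p.2 : zmodule X) x.
Proof.
rewrite /tensor_lift; set h := fglift _.
have hB : {morph h : x y / x - y} by exact: lift_is_additive.
have hU p : h << p >> = phi p.1 p.2 by rewrite /h liftU scale1r.
suff h0 y : tensor_null y -> h y = 0.
  apply/eqP; rewrite -subr_eq0 -hB; apply/eqP/h0.
  by apply/tensor_eq; rewrite reprK.
elim=> {y}[|y z _ hy _ hz|a a' b|a b b'|r a b].
- by rewrite -[X in h X](subrr 0) hB subrr.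
- by rewrite hB hy hz subr0.
- by rewrite !hB !hU /= phiDl -addrA -opprD subrr.
- by rewrite !hB !hU /= phiDr -addrA -opprD subrr.
- by rewrite hB !hU /= phiZ subrr.
Qed.

Lemma tensor_lift_pure a b : tensor_lift (pure_tensor a b) = phi a b.
Proof. by rewrite tensor_lift_pi liftU scale1r. Qed.

Lemma tensor_liftB : {morph tensor_lift : x y / x - y}.
Proof.
move=> x y; rewrite -{1}[x]reprK -{1}[y]reprK -pi_oppr -pi_addr.
rewrite tensor_lift_pi; exact: (@lift_is_additive _ _ (zmodule X)).
Qed.

End TensorUniversal.

(** * Corners of a ring cut out by a central idempotent *)

(** [factor_inj] is not unital: [factor_inj 1] is the central idempotent e, the
    factor T is e S, and [factor_proj] is multiplication by e.  These axioms are
    invariant under passing to the opposite rings. *)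
Record ring_factor (S T : pzRingType) := RingFactor {
  factor_proj : S -> T;
  factor_inj : T -> S;
  factor_projB : {morph factor_proj : x y / x - y};
  factor_projM : {morph factor_proj : x y / x * y};
  factor_proj1 : factor_proj 1 = 1;
  factor_injK : cancel factor_inj factor_proj;
  factor_projK : forall r, factor_inj (factor_proj r) = factor_inj 1 * r;
  factor_central : forall r, factor_inj 1 * r = r * factor_inj 1
}.

Section FactorTheory.
Variables (S T : pzRingType) (F : ring_factor S T).
Local Notation e := (factor_inj F 1).

Lemma factor_projD : {morph factor_proj F : x y / x + y}.
Proof.
move=> x y; have p0 : factor_proj F 0 = 0.
  by rewrite -(subrr 0) factor_projB subrr.
by rewrite -{1}[y]opprK factor_projB -[- y]sub0r factor_projB p0 sub0r opprK.
Qed.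

Lemma factor_idem_inj t : e * factor_inj F t = factor_inj F t.
Proof. by rewrite -factor_projK factor_injK. Qed.

Lemma factor_injB : {morph factor_inj F : x y / x - y}.
Proof.
move=> x y; rewrite -{1}[x](factor_injK F) -{1}[y](factor_injK F) -factor_projB.
by rewrite factor_projK mulrBr !factor_idem_inj.
Qed.

Lemma factor_injD : {morph factor_inj F : x y / x + y}.
Proof.
move=> x y; rewrite -{1}[x](factor_injK F) -{1}[y](factor_injK F) -factor_projD.
by rewrite factor_projK mulrDr !factor_idem_inj.
Qed.

Lemma factor_injM : {morph factor_inj F : x y / x * y}.
Proof.
move=> x y; rewrite -{1}[x](factor_injK F) -{1}[y](factor_injK F) -factor_projM.
by rewrite factor_projK mulrA factor_idem_inj.
Qed.

Lemma factor_op_projM :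
  {morph (factor_proj F : S^c -> T^c) : x y / x * y}.
Proof. by move=> x y; exact: (factor_projM F y x). Qed.

Lemma factor_op_projK (r : S^c) :
  (factor_inj F (factor_proj F r) : S^c) = (e : S^c) * r.
Proof. by rewrite factor_projK factor_central. Qed.

Lemma factor_op_central (r : S^c) : (e : S^c) * r = r * (e : S^c).
Proof. exact: (esym (factor_central F r)). Qed.

(** Right modules are left modules over the opposite ring, so the theory of
    components covers them through this corner. *)
Definition factor_op : ring_factor S^c T^c :=
  @RingFactor S^c T^c (factor_proj F) (factor_inj F) (@factor_projB _ _ F)
    factor_op_projM (factor_proj1 F) (factor_injK F) factor_op_projK
    factor_op_central.

End FactorTheory.

(** * Components of modules and maps *)

(** M' is a copy of e M.  Both e M itself and the i-th term of a direct sum over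
    a product ring are of this form, and so is a T-module seen as an
    S-module. *)
Record component (S T : pzRingType) (F : ring_factor S T) (M : lmodType S)
    (M' : lmodType T) := Component {
  component_summand :> summand M M';
  component_projZ : forall r x, summand_proj component_summand (r *: x) =
    factor_proj F r *: summand_proj component_summand x;
  component_projK : forall x,
    summand_inj component_summand (summand_proj component_summand x) =
    factor_inj F 1 *: x
}.

Section ComponentMap.
Variables (S T : pzRingType) (F : ring_factor S T).

(** The image of the injection is e M, on which r and e r act alike. *)
Lemma component_injZ (M : lmodType S) (M' : lmodType T)
    (c : component F M M') r x :
  summand_inj c (factor_proj F r *: x) = r *: summand_inj c x.
Proof.
rewrite -[x in LHS](summand_injK c) -component_projZ component_projK.
by rewrite scalerA factor_central -scalerA -(component_projK c) summand_injK.
Qed.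

Variables (A B : lmodType S) (A' B' : lmodType T).
Variables (a : component F A A') (b : component F B B') (f : {linear A -> B}).

Definition component_map : A' -> B' := summand_proj b \o f \o summand_inj a.

Fact component_map_linear : linear component_map.
Proof.
move=> t x y; rewrite /component_map /= -{1}[t](factor_injK F) raddfD.
by rewrite component_injZ linearP raddfD component_projZ factor_injK.
Qed.

HB.instance Definition _ :=
  GRing.isLinear.Build T A' B' _ component_map component_map_linear.

Lemma component_map_hom : summand_hom a b f component_map.
Proof.
split=> x; rewrite /component_map /=.
  by rewrite component_projK linearZ /= component_projZ factor_injK scale1r.
by rewrite component_projK -linearZ /= -(component_projK a) summand_injK.
Qed.

End ComponentMap.

Section ComponentLift.
Variables (S T : pzRingType) (F : ring_factor S T).
Variables (A B : lmodType S) (A' B' : lmodType T).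
Variables (a : component F A A') (b : component F B B') (h : {linear A' -> B'}).

Definition component_lift : A -> B := summand_inj b \o h \o summand_proj a.

Fact component_lift_linear : linear component_lift.
Proof.
move=> r x y; rewrite /component_lift /= raddfD component_projZ linearP.
by rewrite raddfD component_injZ.
Qed.

HB.instance Definition _ :=
  GRing.isLinear.Build S A B _ component_lift component_lift_linear.

End ComponentLift.

Section ComponentModule.
Variables (S T : pzRingType) (F : ring_factor S T) (M : lmodType S).
Local Notation e := (factor_inj F 1).

(** The submodule e M consists of the fixed points of e, as e is idempotent. *)
Definition component_pred : {pred M} := [pred x | e *: x == x].

Fact component_zmod_closed : zmod_closed component_pred.
Proof.
split=> [|x y /eqP ex /eqP ey]; rewrite inE ?scaler0 //.
by rewrite scalerBr ex ey.
Qed.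

HB.instance Definition _ := GRing.isZmodClosed.Build M component_pred
  component_zmod_closed.

Record component_mod : Type := ComponentMod
  { component_val : M; component_valP : component_val \in component_pred }.

HB.instance Definition _ := [isSub for component_val].
HB.instance Definition _ := [Choice of component_mod by <:].
HB.instance Definition _ := [SubChoice_isSubZmodule of component_mod by <:].

Lemma component_valE (x : component_mod) : e *: val x = val x.
Proof. exact/eqP/(component_valP x). Qed.

Fact component_scale_proof (r : S) (x : M) : r *: (e *: x) \in component_pred.
Proof.
by rewrite inE !scalerA -mulrA -factor_central mulrA factor_idem_inj.
Qed.

Definition component_scale (t : T) (x : component_mod) : component_mod :=
  ComponentMod (component_scale_proof (factor_inj F t) (val x)).

Fact component_scaleE t x : val (component_scale t x) = factor_inj F t *: val x.
Proof. by rewrite /= component_valE. Qed.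

Fact component_scaleA a b x :
  component_scale a (component_scale b x) = component_scale (a * b) x.
Proof. by apply: val_inj; rewrite !component_scaleE scalerA factor_injM. Qed.

Fact component_scale1 : left_id 1 component_scale.
Proof.
by move=> x; apply: val_inj; rewrite component_scaleE component_valE.
Qed.

Fact component_scaleDr : right_distributive component_scale +%R.
Proof.
move=> a x y; apply: val_inj.
rewrite component_scaleE [val (x + y)]raddfD scalerDr.
by rewrite [RHS]raddfD; congr (_ + _); apply/esym/component_scaleE.
Qed.

Fact component_scaleDl x : {morph component_scale^~ x : a b / a + b}.
Proof.
move=> a b; apply: val_inj; rewrite component_scaleE factor_injD scalerDl.
by rewrite [RHS]raddfD; congr (_ + _); apply/esym/component_scaleE.
Qed.

HB.instance Definition _ := GRing.Zmodule_isLmodule.Build T component_mod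
  component_scaleA component_scale1 component_scaleDr component_scaleDl.

Fact component_mod_projP (x : M) : e *: x \in component_pred.
Proof. by rewrite -[e *: x]scale1r component_scale_proof. Qed.

Definition component_mod_proj (x : M) : component_mod :=
  ComponentMod (component_mod_projP x).

Fact component_mod_projB : {morph component_mod_proj : x y / x - y}.
Proof. by move=> x y; apply: val_inj; rewrite raddfB /= scalerBr. Qed.

HB.instance Definition _ := GRing.isZmodMorphism.Build M component_mod
  component_mod_proj component_mod_projB.

Fact component_mod_injK :
  cancel (val : component_mod -> M) component_mod_proj.
Proof. by move=> x; apply: val_inj; rewrite /= component_valE. Qed.

Fact component_mod_projZ r x :
  component_mod_proj (r *: x) = factor_proj F r *: component_mod_proj x.
Proof.
apply: val_inj; rewrite [RHS]component_scaleE /= factor_projK !scalerA.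
by rewrite -mulrA -factor_central mulrA factor_idem_inj.
Qed.

Definition component_mod_component : component F M component_mod :=
  @Component S T F M component_mod (Summand component_mod_injK)
    component_mod_projZ (fun=> erefl).

End ComponentModule.

Arguments component_mod_component {S T} F M.

(** A T-module becomes an S-module through [factor_proj]; it is its own
    component. *)
Definition res_mod (S T : pzRingType) (F : ring_factor S T) (N : lmodType T) :
  Type := N.

Section Restriction.
Variables (S T : pzRingType) (F : ring_factor S T) (N : lmodType T).
Local Notation res_mod := (res_mod F N).

HB.instance Definition _ := GRing.Zmodule.on res_mod.

Definition res_scale (r : S) (x : res_mod) : res_mod :=
  factor_proj F r *: (x : N).

Fact res_scaleA a b x : res_scale a (res_scale b x) = res_scale (a * b) x.
Proof. by rewrite /res_scale scalerA factor_projM. Qed.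

Fact res_scale1 : left_id 1 res_scale.
Proof. by move=> x; rewrite /res_scale factor_proj1 scale1r. Qed.

Fact res_scaleDr : right_distributive res_scale +%R.
Proof. by move=> a x y; apply: scalerDr. Qed.

Fact res_scaleDl x : {morph res_scale^~ x : a b / a + b}.
Proof. by move=> a b; rewrite /res_scale factor_projD scalerDl. Qed.

HB.instance Definition _ := GRing.Zmodule_isLmodule.Build S res_mod
  res_scaleA res_scale1 res_scaleDr res_scaleDl.

Fact res_projK (x : res_mod) : x = factor_inj F 1 *: x.
Proof. by rewrite -[RHS]/(factor_proj F _ *: (x : N)) factor_injK scale1r. Qed.

Definition res_component : component F res_mod N :=
  @Component S T F res_mod N
    (@Summand res_mod N (@idfun N) (@idfun N) (fun=> erefl))
    (fun _ _ => erefl) res_projK.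

End Restriction.

Arguments res_component {S T} F N.

Section RestrictionMap.
Variables (S T : pzRingType) (F : ring_factor S T).

Definition res_map (A B : lmodType T) (f : {linear A -> B}) :
    res_mod F A -> res_mod F B := f.

Fact res_map_linear (A B : lmodType T) (f : {linear A -> B}) :
  linear (res_map f).
Proof. by move=> r x y; apply: linearP. Qed.

HB.instance Definition _ (A B : lmodType T) (f : {linear A -> B}) :=
  GRing.isLinear.Build S (res_mod F A) (res_mod F B) _ (res_map f)
    (res_map_linear f).

Lemma res_map_hom (A B : lmodType T) (f : {linear A -> B}) :
  summand_hom (res_component F A) (res_component F B) (res_map f) f.
Proof. by []. Qed.

End RestrictionMap.

Arguments res_map {S T} F {A B} f.

Section Injective.
Variables (S T : pzRingType) (F : ring_factor S T).

(** An extension problem over S restricts to the components, where J is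
    injective, and the solution h there gives inj \o h \o proj on B.  This
    extends g because e acts as the identity on the target. *)
Lemma injective_res (J : lmodType T) :
  injective_mod J -> injective_mod (res_mod F J).
Proof.
move=> injJ A B f g injf.
have a := component_mod_component F A; have b := component_mod_component F B.
have j := res_component F J.
have [|h hE] := injJ _ _ (component_map a b f) (component_map a j g).
  exact: injective_summand (component_map_hom a b f) injf.
exists (component_lift b j h) => x.
rewrite /= /component_lift /= (component_map_hom a b f).1 hE /=.
by rewrite -(component_map_hom a j g).1 component_projK -res_projK.
Qed.

(** An extension problem over T is also one over S with values in M; the
    projection brings the solution back to M'. *)
Lemma injective_component (M : lmodType S) (M' : lmodType T)
    (c : component F M M') : injective_mod M -> injective_mod M'.
Proof.
move=> injM A B f g injf.
have [h hE] := injM (res_mod F A) (res_mod F B) (res_map F f)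
  (component_lift (res_component F A) c g) injf.
exists (component_map (res_component F B) c h) => x.
rewrite /= /component_map /=.
by rewrite [X in summand_proj c X](hE x) /= /component_lift /= summand_injK.
Qed.

End Injective.

(** * Components of tensor products *)

Section TensorComponent.
Variables (S T : pzRingType) (F : ring_factor S T).
Variables (A : lmodType S^c) (A' : lmodType T^c).
Variable a : component (factor_op F) A A'.
Variables (B : lmodType S) (B' : lmodType T) (b : component F B B').

Let proj_pure x y : tensor A' B' :=
  pure_tensor (summand_proj a x) (summand_proj b y).
Let inj_pure x y : tensor A B :=
  pure_tensor (summand_inj a x) (summand_inj b y).

Fact proj_pureDl x x' y : proj_pure (x + x') y = proj_pure x y + proj_pure x' y.
Proof. by rewrite /proj_pure raddfD pure_tensorDl. Qed.

Fact proj_pureDr x y y' : proj_pure x (y + y') = proj_pure x y + proj_pure x y'.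
Proof. by rewrite /proj_pure raddfD pure_tensorDr. Qed.

Fact proj_pureZ (r : S) x y :
  proj_pure ((r : S^c) *: x) y = proj_pure x (r *: y).
Proof. by rewrite /proj_pure !component_projZ -pure_tensorZ. Qed.

Fact inj_pureDl x x' y : inj_pure (x + x') y = inj_pure x y + inj_pure x' y.
Proof. by rewrite /inj_pure raddfD pure_tensorDl. Qed.

Fact inj_pureDr x y y' : inj_pure x (y + y') = inj_pure x y + inj_pure x y'.
Proof. by rewrite /inj_pure raddfD pure_tensorDr. Qed.

Fact inj_pureZ (t : T) x y : inj_pure ((t : T^c) *: x) y = inj_pure x (t *: y).
Proof.
rewrite /inj_pure -{2}[t](factor_injK F) component_injZ -pure_tensorZ.
by rewrite -(component_injZ a) factor_injK.
Qed.

Definition tensor_proj : tensor A B -> tensor A' B' := tensor_lift proj_pure.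
Definition tensor_inj : tensor A' B' -> tensor A B := tensor_lift inj_pure.

HB.instance Definition _ := GRing.isZmodMorphism.Build _ _ tensor_proj
  (tensor_liftB proj_pureDl proj_pureDr proj_pureZ).

HB.instance Definition _ := GRing.isZmodMorphism.Build _ _ tensor_inj
  (tensor_liftB inj_pureDl inj_pureDr inj_pureZ).

Lemma tensor_proj_pure x y :
  tensor_proj (pure_tensor x y) =
  pure_tensor (summand_proj a x) (summand_proj b y).
Proof. exact: tensor_lift_pure proj_pureDl proj_pureDr proj_pureZ _ _. Qed.

Lemma tensor_inj_pure x y :
  tensor_inj (pure_tensor x y) =
  pure_tensor (summand_inj a x) (summand_inj b y).
Proof. exact: tensor_lift_pure inj_pureDl inj_pureDr inj_pureZ _ _. Qed.

Fact tensor_injK : cancel tensor_inj tensor_proj.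
Proof.
apply: (eq_tensor (f := tensor_proj \o tensor_inj) (g := idfun)) => x y /=.
by rewrite tensor_inj_pure tensor_proj_pure !summand_injK.
Qed.

Definition tensor_summand : summand (tensor A B) (tensor A' B') :=
  Summand tensor_injK.

(** The idempotent moves across the tensor sign: e a (x) e b = a (x) e e b. *)
Lemma tensor_summand_projK_pure x y :
  tensor_inj (tensor_proj (pure_tensor x y)) =
  pure_tensor x (factor_inj F 1 *: y).
Proof.
rewrite tensor_proj_pure tensor_inj_pure !component_projK.
by rewrite [LHS]pure_tensorZ scalerA factor_idem_inj.
Qed.

End TensorComponent.

Lemma tensor_map_hom (S T : pzRingType) (F : ring_factor S T)
    (A1 A2 : lmodType S^c) (A1' A2' : lmodType T^c)
    (B1 B2 : lmodType S) (B1' B2' : lmodType T)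
    (a1 : component (factor_op F) A1 A1') (a2 : component (factor_op F) A2 A2')
    (b1 : component F B1 B1') (b2 : component F B2 B2')
    (f : {linear A1 -> A2}) (f' : {linear A1' -> A2'})
    (g : {linear B1 -> B2}) (g' : {linear B1' -> B2'}) :
  summand_hom a1 a2 f f' -> summand_hom b1 b2 g g' ->
  summand_hom (tensor_summand a1 b1) (tensor_summand a2 b2)
    (tensor_map f g) (tensor_map f' g').
Proof.
move=> [pf qf] [pg qg]; split=> /=.
- apply: (eq_tensor (f := tensor_proj a2 b2 \o tensor_map f g)
    (g := tensor_map f' g' \o tensor_proj a1 b1)) => x y /=.
  by rewrite tensor_map_pure !tensor_proj_pure tensor_map_pure pf pg.
- apply: (eq_tensor (f := tensor_map f g \o tensor_inj a1 b1)
    (g := tensor_inj a2 b2 \o tensor_map f' g')) => x y /=.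
  by rewrite tensor_map_pure !tensor_inj_pure tensor_map_pure qf qg.
Qed.

Section Complete.
Variables (I : finType) (S : pzRingType) (T : I -> pzRingType).
Variable F : forall i, ring_factor S (T i).
Hypothesis sum_idem : \sum_i factor_inj (F i) 1 = 1.

Lemma component_spanning (M : lmodType S) (M_ : forall i, lmodType (T i))
    (c : forall i, component (F i) M (M_ i)) : spanning c.
Proof.
move=> x; rewrite (eq_bigr (fun i => factor_inj (F i) 1 *: x)) => [|i _].
  by rewrite -scaler_suml sum_idem scale1r.
exact: component_projK.
Qed.

(** On a pure tensor this is the sum of the x (x) e_i y, and the e_i y add up
    to y. *)
Lemma tensor_spanning (A : lmodType S^c) (A_ : forall i, lmodType (T i)^c)
    (B : lmodType S) (B_ : forall i, lmodType (T i))
    (a : forall i, component (factor_op (F i)) A (A_ i))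
    (b : forall i, component (F i) B (B_ i)) :
  spanning (fun i => tensor_summand (a i) (b i)).
Proof.
elim/tensor_sub_ind => [|z w IHz IHw|x y].
- by rewrite big1 // => i _; rewrite !raddf0.
- rewrite -{2}IHz -{2}IHw -sumrB.
  by apply: eq_bigr => i _; rewrite !raddfB.
- pose ey i := factor_inj (F i) 1 *: y.
  rewrite (eq_bigr (fun i => pure_tensor x (ey i))) => [|i _].
    rewrite -[y in RHS]scale1r -sum_idem scaler_suml.
    have pD : {morph @pure_tensor S A B x : u v / u + v}.
      by move=> u v; apply: pure_tensorDr.
    have p0 : pure_tensor x (0 : B) = 0.
      by apply: (addrI (pure_tensor x (0 : B))); rewrite -pD !addr0.
    exact/esym/(big_morph _ pD p0).
  exact: tensor_summand_projK_pure.
Qed.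

End Complete.

(** * Flatness of components *)

(** For an injection of right T-modules, regarded over S, the map obtained by
    tensoring with M' over T is a summand of the one obtained with M over S. *)
Lemma flat_component (S T : pzRingType) (F : ring_factor S T)
    (M : lmodType S) (M' : lmodType T) (c : component F M M') :
  flat M -> flat M'.
Proof.
move=> flatM A A' f injf.
have hf := tensor_map_hom (res_map_hom (factor_op F) f) (summand_hom_id c).
exact: injective_summand hf
  (flatM (res_mod (factor_op F) A) (res_mod (factor_op F) A')
    (res_map _ f) injf).
Qed.

(** An injection of right S-modules has injective components, and tensoring with
    M is the sum of tensoring the components with the M_ i. *)
Lemma flat_components (I : finType) (S : pzRingType) (T : I -> pzRingType)
    (F : forall i, ring_factor S (T i)) (M : lmodType S)
    (M_ : forall i, lmodType (T i)) (c : forall i, component (F i) M (M_ i)) :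
  \sum_i factor_inj (F i) 1 = 1 -> (forall i, flat (M_ i)) -> flat M.
Proof.
move=> sum_idem flatM A A' f injf.
pose a i := component_mod_component (factor_op (F i)) A.
pose a' i := component_mod_component (factor_op (F i)) A'.
have hf_ i := component_map_hom (a i) (a' i) f.
have hf i := tensor_map_hom (hf_ i) (summand_hom_id (c i)).
apply: (injective_spanning (tensor_spanning sum_idem a c) hf) => i.
by apply: flatM; apply: injective_summand (hf_ i) injf.
Qed.

(** * Gorenstein flat modules *)

Definition linear_of (S : pzRingType) (A B : lmodType S) (f : A -> B)
    (f_lin : linear f) : {linear A -> B} :=
  HB.pack f (GRing.isLinear.Build S A B *:%R f f_lin).

Lemma lmod_iso_sym (S : pzRingType) (M N : lmodType S) :
  lmod_iso M N -> lmod_iso N M.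
Proof.
case=> f [g fK gK]; have g_lin := can2_linear fK gK.
exists (linear_of g_lin).
by exists f.
Qed.

Lemma bijective_of_inj_surj (A B : Type) (f : A -> B) :
  injective f -> (forall y, exists x, y = f x) -> bijective f.
Proof.
move=> injf /(_ _)/cid surf; exists (fun y => projT1 (surf y)) => [x|y].
  by apply: injf; rewrite -(projT2 (surf (f x))).
by rewrite -(projT2 (surf y)).
Qed.

Section ImageEmbedding.
Variables (S : pzRingType) (M A B : lmodType S) (e : {linear A -> B}).

(** An isomorphism of M with the image of e, seen as a map into B: in this form
    it can be projected to components and glued. *)
Definition embeds_as_image (j : {linear M -> B}) : Prop :=
  injective j /\ forall y, (exists x, y = e x) <-> (exists m, y = j m).

Lemma iso_image_embedding :
  lmod_iso M (image_mod e) <-> exists j, embeds_as_image j.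
Proof.
split=> [[f [g fK gK]]|[j [injj imj]]].
  have j_lin : linear (val \o f) by move=> r x y /=; rewrite !linearP.
  exists (linear_of j_lin).
  split=> [x y /= /val_inj/(can_inj fK)//|y].
  split=> [ex|[m ->]].
    have yP : y \in image_pred e by apply/asboolP.
    by exists (g (ImageMod yP)); rewrite /= gK.
  exact/asboolP/(image_valP (f m)).
have jP m : j m \in image_pred e by apply/asboolP/imj; exists m.
pose f m : image_mod e := ImageMod (jP m).
have f_lin : linear f.
  by move=> r x y; apply: val_inj; rewrite linearP /= linearP.
exists (linear_of f_lin).
apply: bijective_of_inj_surj => [x y /(congr1 val)/injj//|y].
have /asboolP/imj[m yE] := image_valP y.
by exists m; apply: val_inj.
Qed.

End ImageEmbedding.

(** The data witnessing Gorenstein flatness, in a type rather than under an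
    existential, so that a family of them can be chosen. *)
Record complete_flat_resolution (S : pzRingType) (M : lmodType S) :=
  CompleteFlatResolution {
  cfr_left : nat -> lmodType S;
  cfr_right : nat -> lmodType S;
  cfr_dl : forall k, {linear cfr_left k.+1 -> cfr_left k};
  cfr_mid : {linear cfr_left 0 -> cfr_right 0};
  cfr_dr : forall k, {linear cfr_right k -> cfr_right k.+1};
  cfr_emb : {linear M -> cfr_right 0};
  cfr_left_flat : forall k, flat (cfr_left k);
  cfr_right_flat : forall k, flat (cfr_right k);
  cfr_exact : @exact_biseq cfr_left cfr_right cfr_dl cfr_mid cfr_dr;
  cfr_embP : embeds_as_image cfr_mid cfr_emb;
  cfr_tensor_exact : forall I : lmodType S^c, injective_mod I ->
    @exact_biseq (fun k => tensor I (cfr_left k))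
      (fun k => tensor I (cfr_right k))
      (fun k => tensor_map (@idfun I) (cfr_dl k))
      (tensor_map (@idfun I) cfr_mid)
      (fun k => tensor_map (@idfun I) (cfr_dr k))
}.

Lemma gorenstein_flatP (S : pzRingType) (M : lmodType S) :
  gorenstein_flat M <-> inhabited (complete_flat_resolution M).
Proof.
split=> [[L [R [dl [e [dr [fl ex /iso_image_embedding[j embj] tex]]]]]]|].
  split; exists L R dl e dr j => // k; by case: (fl k).
case=> [[L R dl e dr j fL fR ex embj tex]]; exists L, R, dl, e, dr.
split=> //.
by apply/iso_image_embedding; exists j.
Qed.

(** The components of a complete flat resolution of M form one of M'.  To test
    it against an injective T-module J, tensor the original with J seen as an
    S-module: the tensored components are a summand of the result. *)
Lemma gorenstein_flat_component (S T : pzRingType) (F : ring_factor S T)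
    (M : lmodType S) (M' : lmodType T) (c : component F M M') :
  gorenstein_flat M -> gorenstein_flat M'.
Proof.
move=> /gorenstein_flatP[[L R dl e dr j fL fR ex embj tex]].
pose L' k := component_mod F (L k); pose R' k := component_mod F (R k).
pose cL k := component_mod_component F (L k).
pose cR k := component_mod_component F (R k).
have hdl k := component_map_hom (cL k.+1) (cL k) (dl k).
have he := component_map_hom (cL 0%N) (cR 0%N) e.
have hdr k := component_map_hom (cR k) (cR k.+1) (dr k).
have hj := component_map_hom c (cR 0%N) j.
apply/gorenstein_flatP; split.
exists L' R' (fun k => component_map (cL k.+1) (cL k) (dl k))
  (component_map (cL 0%N) (cR 0%N) e)
  (fun k => component_map (cR k) (cR k.+1) (dr k))
  (component_map c (cR 0%N) j).
- by move=> k; apply: flat_component (cL k) (fL k).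
- by move=> k; apply: flat_component (cR k) (fR k).
- exact: exact_biseq_summand hdl he hdr ex.
- split=> [|y]; first exact: injective_summand hj embj.1.
  by rewrite (image_summand he) (image_summand hj); apply: embj.2.
- move=> J injJ.
  have hJ := summand_hom_id (res_component (factor_op F) J).
  exact: exact_biseq_summand (fun k => tensor_map_hom hJ (hdl k))
    (tensor_map_hom hJ he) (fun k => tensor_map_hom hJ (hdr k))
    (tex _ (injective_res injJ)).
Qed.

(** * The factors of a product ring *)

Section ProductFactors.
Variables (I : finType) (R : I -> pzRingType).

Definition single (V : I -> zmodType) i (x : V i) : forall j, V j :=
  dfwith (T := V) (fun j => 0 : V j) x.

Lemma single_in (V : I -> zmodType) i (x : V i) : single x i = x.
Proof. exact: dfwith_in. Qed.

Lemma single_out (V : I -> zmodType) i (x : V i) j : i != j -> single x j = 0.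
Proof. exact: dfwith_out. Qed.

Section ProductFactor.
Variable i : I.

Fact prod_factor_projK (r : prod_ring R) :
  single (r i) = (single (1 : R i) : prod_ring R) * r.
Proof.
apply: functional_extensionality_dep => j; rewrite -[RHS]/(single _ j * r j).
have [<-|ij] := eqVneq i j; first by rewrite !single_in mul1r.
by rewrite !single_out // mul0r.
Qed.

Fact prod_factor_central (r : prod_ring R) :
  (single (1 : R i) : prod_ring R) * r = r * (single (1 : R i) : prod_ring R).
Proof.
apply: functional_extensionality_dep => j.
rewrite -[LHS]/(single _ j * r j) -[RHS]/(r j * single _ j).
have [<-|ij] := eqVneq i j; first by rewrite !single_in mul1r mulr1.
by rewrite !single_out // mul0r mulr0.
Qed.

Definition prod_factor : ring_factor (prod_ring R) (R i) :=
  @RingFactor (prod_ring R) (R i) (fun r => r i) (@single R i)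
    (fun _ _ => erefl) (fun _ _ => erefl) erefl (@single_in R i)
    prod_factor_projK prod_factor_central.

Variable N_ : forall i, lmodType (R i).

Let proj (u : dsum_mod N_) : N_ i := u i.
Let inj : N_ i -> dsum_mod N_ := @single N_ i.

Fact dsum_projB : {morph proj : u v / u - v}.
Proof. by []. Qed.

Fact dsum_injB : {morph inj : x y / x - y}.
Proof.
move=> x y; apply: functional_extensionality_dep => j.
rewrite -[RHS]/(inj x j - inj y j) /inj.
have [<-|ij] := eqVneq i j; first by rewrite !single_in.
by rewrite !single_out // subr0.
Qed.

HB.instance Definition _ := GRing.isZmodMorphism.Build _ _ proj dsum_projB.
HB.instance Definition _ := GRing.isZmodMorphism.Build _ _ inj dsum_injB.

Fact dsum_projK u :
  inj (proj u) = (single (1 : R i) : prod_ring R) *: u.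
Proof.
apply: functional_extensionality_dep => j.
rewrite -[RHS]/(single _ j *: u j) /inj /proj.
have [<-|ij] := eqVneq i j; first by rewrite !single_in scale1r.
by rewrite !single_out // scale0r.
Qed.

Definition dsum_component : component prod_factor (dsum_mod N_) (N_ i) :=
  @Component _ _ prod_factor (dsum_mod N_) (N_ i)
    (@Summand (dsum_mod N_) (N_ i) proj inj (@single_in N_ i))
    (fun _ _ => erefl) dsum_projK.

End ProductFactor.

Lemma prod_factor_sum : \sum_i factor_inj (prod_factor i) 1 = 1.
Proof.
apply: functional_extensionality_dep => j; rewrite -[RHS]/1.
rewrite (big_morph (fun x : prod_ring R => x j) (id1 := 0) (op1 := +%R)) //.
rewrite (bigD1 j) //= single_in big1 ?addr0 // => i ij.
exact: single_out.
Qed.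

Section DsumMap.
Variables (A_ B_ : forall i, lmodType (R i)).
Variable f_ : forall i, {linear A_ i -> B_ i}.

Definition dsum_map (u : dsum_mod A_) : dsum_mod B_ := fun i => f_ i (u i).

Fact dsum_map_linear : linear dsum_map.
Proof.
by move=> r x y; apply: functional_extensionality_dep => i; apply: linearP.
Qed.

HB.instance Definition _ :=
  GRing.isLinear.Build _ _ _ _ dsum_map dsum_map_linear.

Lemma dsum_map_hom i :
  summand_hom (dsum_component i A_) (dsum_component i B_) dsum_map (f_ i).
Proof.
split=> // x; apply: functional_extensionality_dep => j /=.
rewrite /dsum_map; have [<-|ij] := eqVneq i j; first by rewrite !single_in.
by rewrite !single_out // raddf0.
Qed.

End DsumMap.

Lemma embeds_as_image_dsum (M_ A_ B_ : forall i, lmodType (R i))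
    (e_ : forall i, {linear A_ i -> B_ i})
    (j_ : forall i, {linear M_ i -> B_ i}) :
  (forall i, embeds_as_image (e_ i) (j_ i)) ->
  embeds_as_image (dsum_map e_) (dsum_map j_).
Proof.
move=> embj; pose span := component_spanning prod_factor_sum.
split=> [|y].
  apply: (injective_spanning (span _ _ _) (dsum_map_hom j_)) => i.
  exact: (embj i).1.
rewrite (image_spanning (span _ _ _) (dsum_map_hom e_)).
rewrite (image_spanning (span _ _ _) (dsum_map_hom j_)).
by split=> h i; apply/(embj i).2/h.
Qed.

(** The direct sum of complete flat resolutions is one.  To test it against an
    injective module J, test the i-th resolution against the i-th component of
    J, which is injective. *)
Lemma gorenstein_flat_dsum (M_ : forall i, lmodType (R i)) :
  (forall i, gorenstein_flat (M_ i)) -> gorenstein_flat (dsum_mod M_).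
Proof.
move=> gf; have r i : complete_flat_resolution (M_ i).
  by apply: inhabited_witness; apply/gorenstein_flatP.
pose L_ k i := cfr_left (r i) k; pose Q_ k i := cfr_right (r i) k.
pose dl_ k i : {linear L_ k.+1 i -> L_ k i} := cfr_dl (r i) k.
pose e_ i : {linear L_ 0%N i -> Q_ 0%N i} := cfr_mid (r i).
pose dr_ k i : {linear Q_ k i -> Q_ k.+1 i} := cfr_dr (r i) k.
pose cL k i := dsum_component i (L_ k); pose cQ k i := dsum_component i (Q_ k).
have spanL k := component_spanning prod_factor_sum (cL k).
have spanQ k := component_spanning prod_factor_sum (cQ k).
have hdl k := dsum_map_hom (dl_ k); have he := dsum_map_hom e_.
have hdr k := dsum_map_hom (dr_ k).
apply/gorenstein_flatP; split.
exists (fun k => dsum_mod (L_ k)) (fun k => dsum_mod (Q_ k))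
  (fun k => dsum_map (dl_ k)) (dsum_map e_) (fun k => dsum_map (dr_ k))
  (dsum_map (fun i => cfr_emb (r i))).
- by move=> k; apply: flat_components (cL k) prod_factor_sum _ => i;
    apply: cfr_left_flat.
- by move=> k; apply: flat_components (cQ k) prod_factor_sum _ => i;
    apply: cfr_right_flat.
- apply: (exact_biseq_spanning (sL := cL) (sR := cQ) (e := dsum_map e_)
    (dl := fun k => dsum_map (dl_ k))
    (dr := fun k => dsum_map (dr_ k)) hdl he hdr) => [k|k|i].
  + exact: spanL.
  + exact: spanQ.
  + exact: cfr_exact.
- by apply: embeds_as_image_dsum => i; apply: cfr_embP.
- move=> J injJ.
  pose cJ i := component_mod_component (factor_op (prod_factor i)) J.
  have spanJL k := tensor_spanning prod_factor_sum cJ (cL k).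
  have spanJQ k := tensor_spanning prod_factor_sum cJ (cQ k).
  have hJ i := summand_hom_id (cJ i).
  apply: (exact_biseq_spanning
    (sL := fun k i => tensor_summand (cJ i) (cL k i))
    (sR := fun k i => tensor_summand (cJ i) (cQ k i))
    (dl := fun k => tensor_map (@idfun J) (dsum_map (dl_ k)))
    (e := tensor_map (@idfun J) (dsum_map e_))
    (dr := fun k => tensor_map (@idfun J) (dsum_map (dr_ k)))
    (fun k i => tensor_map_hom (hJ i) (hdl k i))
    (fun i => tensor_map_hom (hJ i) (he i))
    (fun k i => tensor_map_hom (hJ i) (hdr k i))) => [k|k|i].
  + exact: spanJL.
  + exact: spanJQ.
  + exact: cfr_tensor_exact (injective_component (cJ i) injJ).
Qed.

End ProductFactors.

(** * Gorenstein flat dimension *)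

Lemma exact_at_zero (A B C : zmodType) (f : A -> B) (g : B -> C) :
  (forall y : B, y = 0) -> (forall z : C, z = 0) -> exact_at f g.
Proof.
move=> B0 C0 y; split=> _; last by rewrite [g y]C0.
by exists 0; rewrite [LHS]B0 [RHS]B0.
Qed.

Lemma exact_biseq_zero (L R : nat -> zmodType) (dl : forall k, L k.+1 -> L k)
    (e : L 0 -> R 0) (dr : forall k, R k -> R k.+1) :
  (forall k (x : L k), x = 0) -> (forall k (x : R k), x = 0) ->
  exact_biseq dl e dr.
Proof. by move=> L0 R0; split=> *; apply: exact_at_zero. Qed.

Lemma tensor_zero (S : pzRingType) (A : lmodType S^c) (B : lmodType S) :
  (forall b : B, b = 0) -> forall z : tensor A B, z = 0.
Proof.
move=> B0; elim/tensor_sub_ind => [//|x y -> ->|a b]; first by rewrite subr0.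
rewrite (B0 b); apply: (addrI (pure_tensor a 0)).
by rewrite -pure_tensorDr !addr0.
Qed.

(** M itself, repeated with identity maps, is a complete flat resolution: every
    term is zero, before and after tensoring. *)
Lemma gorenstein_flat_zero (S : pzRingType) (M : lmodType S) :
  (forall x : M, x = 0) -> gorenstein_flat M.
Proof.
move=> M0; apply/gorenstein_flatP; split.
have flatM : flat M.
  by move=> A A' f _ x y _; rewrite [x](tensor_zero M0) [y](tensor_zero M0).
exists (fun=> M) (fun=> M) (fun=> idfun) idfun (fun=> idfun) idfun => //.
- exact: exact_biseq_zero.
- by split=> [x y //|y].
- by move=> J _; apply: exact_biseq_zero => k; apply: tensor_zero.
Qed.

(** As for complete flat resolutions, a type from which families can be
    chosen. *)
Record gorenstein_resolution (S : pzRingType) (M : lmodType S) (m : nat) :=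
  GorensteinResolution {
  gres : nat -> lmodType S;
  gres_d : forall k, {linear gres k.+1 -> gres k};
  gres_eps : {linear gres 0 -> M};
  gres_flat : forall k, (k <= m)%N -> gorenstein_flat (gres k);
  gres_zero : forall k, (m < k)%N -> forall x : gres k, x = 0;
  gres_exact : forall k, exact_at (gres_d k.+1) (gres_d k);
  gres_exact0 : exact_at (gres_d 0) gres_eps;
  gres_surj : forall y, exists x, y = gres_eps x
}.

Lemma Gfd_leP (S : pzRingType) (M : lmodType S) (m : nat) :
  Gfd_le M m <-> inhabited (gorenstein_resolution M m).
Proof.
split=> [[G [d [eps [gfG G0 exd exd0 surj]]]]|[[G d eps gfG G0 exd exd0 surj]]].
  by split; exists G d eps.
by exists G, d, eps.
Qed.

(** A shorter resolution already vanishes in the degrees that the longer one may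
    use, and zero modules are Gorenstein flat. *)
Lemma Gfd_le_leq (S : pzRingType) (M : lmodType S) (m n : nat) :
  (m <= n)%N -> Gfd_le M m -> Gfd_le M n.
Proof.
move=> mn [G [d [eps [gfG G0 exd exd0 surj]]]]; exists G, d, eps; split=> // k.
  case: (leqP k m) => [km _|/G0 Gk0 _]; first exact: gfG.
  exact: gorenstein_flat_zero.
by move=> nk; apply/G0/(leq_ltn_trans mn).
Qed.

Lemma Gfd_le_iso (S : pzRingType) (M N : lmodType S) (m : nat) :
  lmod_iso M N -> Gfd_le M m -> Gfd_le N m.
Proof.
move=> [f [g fK gK]] [G [d [eps [gfG G0 exd exd0 surj]]]].
exists G, d, (f \o eps); split=> // [y|y] /=.
  by rewrite -exd0 -(raddf0 f); split=> [/(can_inj fK)|->].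
by have [x gyE] := surj (g y); exists x; rewrite -gyE gK.
Qed.

(** Taking components is exact and preserves Gorenstein flatness. *)
Lemma Gfd_le_component (S T : pzRingType) (F : ring_factor S T)
    (M : lmodType S) (M' : lmodType T) (c : component F M M') (m : nat) :
  Gfd_le M m -> Gfd_le M' m.
Proof.
move=> [G [d [eps [gfG G0 exd exd0 surj]]]].
pose cG k := component_mod_component F (G k).
have hd k := component_map_hom (cG k.+1) (cG k) (d k).
have heps := component_map_hom (cG 0%N) c eps.
exists (fun k => component_mod F (G k)),
  (fun k => component_map (cG k.+1) (cG k) (d k)),
  (component_map (cG 0%N) c eps).
split=> [k km|k mk x|k||].
- exact: gorenstein_flat_component (cG k) (gfG k km).
- by rewrite -[x](summand_injK (cG k)) (G0 k mk (summand_inj _ x)) raddf0.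
- exact: exact_at_summand (hd k.+1) (hd k) (exd k).
- exact: exact_at_summand (hd 0%N) heps exd0.
- exact: surjective_summand heps surj.
Qed.

Lemma Gfd_le_dsum (I : finType) (R : I -> pzRingType)
    (N_ : forall i, lmodType (R i)) (m : nat) :
  (forall i, Gfd_le (N_ i) m) -> Gfd_le (dsum_mod N_) m.
Proof.
move=> gfd; have r i : gorenstein_resolution (N_ i) m.
  by apply: inhabited_witness; apply/Gfd_leP.
pose G_ k i := gres (r i) k.
pose d_ k i : {linear G_ k.+1 i -> G_ k i} := gres_d (r i) k.
pose eps_ i : {linear G_ 0%N i -> N_ i} := gres_eps (r i).
have span V_ := component_spanning (@prod_factor_sum I R)
  (fun i => dsum_component i V_).
have hd k := dsum_map_hom (d_ k); have heps := dsum_map_hom eps_.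
apply/Gfd_leP; split; exists (fun k => dsum_mod (G_ k))
  (fun k => dsum_map (d_ k)) (dsum_map eps_) => [k km|k mk x|k||].
- by apply: gorenstein_flat_dsum => i; apply: gres_flat.
- by apply: functional_extensionality_dep => i; apply: gres_zero.
- apply: (exact_at_spanning (span _) (span _) (hd k.+1) (hd k)) => i.
  exact: gres_exact.
- apply: (exact_at_spanning (span _) (span _) (hd 0%N) heps) => i.
  exact: gres_exact0.
- apply: (surjective_spanning (span _) heps) => i; exact: gres_surj.
Qed.

Lemma Gfd_le_dsumP (I : finType) (R : I -> pzRingType)
    (N_ : forall i, lmodType (R i)) (m : nat) :
  Gfd_le (dsum_mod N_) m <-> forall i, Gfd_le (N_ i) m.
Proof.
split=> [gfd i|]; last exact: Gfd_le_dsum.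
by have := Gfd_le_component (dsum_component i N_) gfd.
Qed.

Section GfdValue.
Variables (S : pzRingType) (M : lmodType S).

Variant Gfd_spec : \bar int -> Prop :=
| GfdFinite m : Gfd_le M m -> (forall k, Gfd_le M k -> (m <= k)%N) ->
    Gfd_spec m%:Z%:E
| GfdInfinite : (forall m, ~ Gfd_le M m) -> Gfd_spec +oo%E.

Lemma GfdP : Gfd_spec (Gfd M).
Proof.
rewrite /Gfd; case: pselect => [h|h].
  case: ex_minnP => m /asboolP lem min; apply: GfdFinite => // k lek.
  by apply/min/asboolP.
by apply: GfdInfinite => m lem; apply: h; exists m; apply/asboolP.
Qed.

Lemma Gfd_ge0 : (0 <= Gfd M)%E.
Proof. by case: GfdP => [m _ _|_]; rewrite ?lee_fin ?leey. Qed.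

(** The finite upper bounds of [Gfd M] determine it, so the theorem reduces to a
    comparison of the predicates [Gfd_le]. *)
Lemma Gfd_leE (m : nat) : (Gfd M <= m%:Z%:E)%E <-> Gfd_le M m.
Proof.
case: GfdP => [k lek min|infM]; last by split=> // /infM.
rewrite lee_fin lez_nat; split=> [km|/min//].
exact: Gfd_le_leq lek.
Qed.

End GfdValue.

Theorem theorem3p4 (n : nat) (R : 'I_n -> pzRingType)
    (N : lmodType (prod_ring R)) (N_ : forall i, lmodType (R i)) :
  lmod_iso N (dsum_mod N_) ->
  Gfd N = supremum 0%E (range (fun i => Gfd (N_ i))).
Proof.
move=> isoN; set A := range _.
have leN m : Gfd_le N m <-> forall i, Gfd_le (N_ i) m.
  rewrite -Gfd_le_dsumP; split; apply: Gfd_le_iso => //.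
  exact: lmod_iso_sym.
have ubN : ubound A (Gfd N).
  move=> _ [i _ <-]; case: (GfdP N) => [m /leN lem _|_]; last exact: leey.
  exact/Gfd_leE.
have lbN y : (0 <= y)%E -> ubound A y -> (Gfd N <= y)%E.
  case: y => [[m|//] _ ubA|_ _|//]; last exact: leey.
  by apply/Gfd_leE/leN => i; apply/Gfd_leE/ubA; exists i.
(* The default value of [supremum] is only taken for n = 0; the bound 0 <= y
   needed otherwise comes from any of the N_ i. *)
rewrite /supremum; case: ifPn => [/eqP A0|/set0P[a Aa]].
  by apply/eqP; rewrite eq_le Gfd_ge0 lbN // A0.
have supN : supremums A (Gfd N).
  split=> // y ubA; apply: lbN => //; apply: le_trans (ubA _ Aa).
  by have [i _ <-] := Aa; apply: Gfd_ge0.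
case: xgetP => [y _ supy|/(_ _ supN)//].
exact: is_subset1_supremums supN supy.
Qed.
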